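(* Let $A_1$ and $A_2$ be Banach algebras and let $\theta\in\Delta_0(A_2)$. Then the following statements hold. (i) If $A_1\times_\theta A_2$ is point amenable, then $A_1$ and $A_2$ are point amenable. (ii) If $A_1\oplus A_2$ is point amenable, then $A_1$ and $A_2$ are point amenable. (iii) If $A_1^\sharp$ is point amenable, then $A_1$ is point amenable. Moreover, the converses of the statements (i), (ii) and (iii) hold when $A_1$ and $A_2$ are essential.
   Context: For a Banach algebra $A$, $\Delta(A)$ is the character space of $A$ (nonzero multiplicative linear functionals) and $\Delta_0(A)=\Delta(A)\cup\{0\}$. A continuous point derivation of $A$ at $\varphi\in\Delta(A)$ is a continuous linear functional $d$ on $A$ with $d(ab)=d(a)\varphi(b)+\varphi(a)d(b)$ for all $a,b\in A$. $A$ is point amenable if there is no nonzero continuous point derivation of $A$ at any element of $\Delta(A)$. $A$ is essential if the linear span of $\{ab: a,b\in A\}$ is dense in $A$. For $\theta\in\Delta_0(A_2)$, the $\theta$-Lau product $A_1\times_\theta A_2$ is the space $A_1\times A_2$ with product $(a_1,a_2)(x_1,x_2)=(a_1x_1+a_1\theta(x_2)+x_1\theta(a_2),\,a_2x_2)$ and norm $\|(a_1,a_2)\|=\|a_1\|+\|a_2\|$. For $\theta=0$ it is the usual direct product $A_1\oplus A_2$; for $A_2=\mathbb{C}$ and $\theta$ the identity map on $\mathbb{C}$ it is $A_1^\sharp$, the unitization of $A_1$. *)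

(* Defs.v *)
From HB Require Import structures.
From mathcomp Require Import all_boot all_order all_algebra.
From mathcomp Require Import complex.
From mathcomp Require Import boolp classical_sets functions reals.
From mathcomp Require Import topology normedtype sequences.

Set Implicit Arguments.
Unset Strict Implicit.
Unset Printing Implicit Defensive.

Import Order.TTheory GRing.Theory Num.Theory.
Import numFieldNormedType.Exports.

Local Open Scope classical_set_scope.
Local Open Scope ring_scope.
Local Open Scope complex_scope.

(* Algebras need not be unital or commutative: the product is the semigroup
   operation [*%g], which is independent of the ring hierarchy. *)
Notation "x ** y" := (x * y)%g (at level 40, left associativity) : ring_scope.

HB.mixin Record isBanachAlgebra (K : numFieldType) A
    & CompleteNormedModule K A & Semigroup A := {
  bmulDl : forall x y z : A, (x + y) ** z = x ** z + y ** z;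
  bmulDr : forall x y z : A, x ** (y + z) = x ** y + x ** z;
  bmulZl : forall (k : K) (x y : A), (k *: x) ** y = k *: (x ** y);
  bmulZr : forall (k : K) (x y : A), x ** (k *: y) = k *: (x ** y);
  normM_le : forall x y : A, `|x ** y| <= `|x| * `|y|
}.

#[short(type="banachAlgType")]
HB.structure Definition BanachAlgebra (K : numFieldType) :=
  {A of CompleteNormedModule K A & Semigroup A & isBanachAlgebra K A}.

Section Characters.
Context (R : realType).
Local Notation C := R[i].
Implicit Type A : banachAlgType C.

(* Continuity is not part of the definition: it is automatic (see
   [Delta0_norm] below). *)
Definition Delta A : set {linear A -> C^o} :=
  [set phi | phi <> \0 /\ forall a b, phi (a ** b) = phi a * phi b].

Arguments Delta : clear implicits.

Definition Delta0 A : set {linear A -> C^o} := Delta A `|` [set \0].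

Arguments Delta0 : clear implicits.

Definition cont_point_derivation A (phi d : {linear A -> C^o}) : Prop :=
  continuous d /\ forall a b, d (a ** b) = d a * phi b + phi a * d b.

Definition point_amenable A : Prop :=
  forall phi, Delta A phi ->
    ~ exists d, cont_point_derivation phi d /\ d <> \0.

Definition lspan (V : lmodType C) (S : set V) : set V :=
  [set x | exists (n : nat) (c : 'I_n -> C) (v : 'I_n -> V),
    (forall i, S (v i)) /\ x = \sum_(i < n) c i *: v i].

Definition essential A : Prop :=
  dense (lspan [set a ** b | a in [set: A] & b in [set: A]]).

End Characters.
Arguments Delta {R} A _.
Arguments Delta0 {R} A _.

Lemma Delta0M (R : realType) (A : banachAlgType R[i]) (theta : Delta0 A) a b :
  set_val theta (a ** b) = set_val theta a * set_val theta b.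
Proof.
have := valP theta; rewrite inE => -[[_ ->//]|/= ->].
by rewrite mul0r.
Qed.

Lemma Delta0Z (R : realType) (A : banachAlgType R[i]) (theta : Delta0 A) k a :
  set_val theta (k *: a) = k * set_val theta a.
Proof. exact: linearZ. Qed.

Section Automatic.
Context (R : realType) (A : banachAlgType R[i]).
Local Notation C := R[i].

Lemma quasi_inverse (y : A) : `|y| < 1 -> exists s, s = y + y ** s.
Proof.
move=> y1.
pose s n := iter n (fun x => y + y ** x) 0.
pose B : C := `|y| / (1 - `|y|).
have y0 : 0 < 1 - `|y| by rewrite subr_gt0.
have B0 : 0 <= B by rewrite divr_ge0// ltW.
have EB : `|y| + `|y| * B = B.
  rewrite /B; apply: (mulIf (lt0r_neq0 y0)).
  by rewrite mulrDl mulrA !divfK ?lt0r_neq0// mulrBr mulr1 subrK.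
have sB n : `|s n| <= B.
  elim: n => [|n IH]; first by rewrite normr0.
  rewrite /s iterS -/(s n) -EB (le_trans (ler_normD _ _))// lerD2l.
  by rewrite (le_trans (normM_le _ _))// ler_wpM2l.
have sD n k : `|s (n + k)%N - s n| <= `|y| ^+ n * B.
  elim: n => [|n IH]; first by rewrite add0n subr0 expr0 mul1r.
  rewrite addSn /s !iterS -/(s n) -/(s (n + k)%N) opprD addrACA subrr add0r.
  have -> : y ** s (n + k)%N - y ** s n = y ** (s (n + k)%N - s n).
    by rewrite bmulDr -[in RHS]scaleN1r bmulZr scaleN1r.
  by rewrite (le_trans (normM_le _ _))// exprS -mulrA ler_wpM2l.
pose r := complex.Re `|y|.
have yr : `|y| = r%:C by rewrite RRe_real// ger0_real.
have r0 : 0 <= r by rewrite -lecR -yr; exact: normr_ge0.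
have r1 : `|r| < 1 by rewrite (ger0_norm r0) -ltcR -yr.
have rB (e : C) : 0 < e -> exists N, forall n, (N <= n)%N -> `|y| ^+ n * B < e.
  move=> e0.
  have eE : e = (complex.Re e)%:C by rewrite RRe_real// gtr0_real.
  have BE : B = (complex.Re B)%:C by rewrite RRe_real// ger0_real.
  have e0' : 0 < complex.Re e by rewrite -ltcR -eE; exact: e0.
  have : (fun n => r ^+ n * complex.Re B) @ \oo --> (0 : R).
    rewrite -[X in _ --> X](mul0r (complex.Re B)); apply: cvgM; last exact: cvg_cst.
    exact: cvg_expr.
  move/cvgrPdist_lt => /(_ _ e0') [N _ NP]; exists N => n Nn.
  have := NP n Nn; rewrite /= sub0r normrN => H.
  rewrite yr eE BE -rmorphXn -rmorphM ltcR.
  exact: le_lt_trans (ler_norm _) H.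
have : cvg (s @ \oo).
  apply: cauchy_cvg; apply/cauchy_exP => e e0.
  have [N NP] := rB _ e0.
  exists (s N); exists N => // n /= Nn.
  rewrite -ball_normE /ball_ /= distrC -(subnKC Nn).
  by rewrite (le_lt_trans (sD _ _))// NP.
move=> /cvg_ex[/= l sl]; exists l; apply/eqP; rewrite -subr_eq0 -normr_eq0.
apply/negPn/negP => nz.
pose e := `|l - (y + y ** l)|.
have e0 : 0 < e by rewrite lt_def nz normr_ge0.
have e2 : 0 < e / 2 by rewrite divr_gt0.
have /cvgrPdist_lt /(_ _ e2) [N _ NP] := sl.
have HN := NP N (leqnn N); have HN1 := NP N.+1 (leqnSn N).
have : e < e.
  have {1}-> : e = `|l - s N.+1 + (s N.+1 - (y + y ** l))|.
    by rewrite addrA subrK.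
  rewrite (splitr e).
  apply: le_lt_trans (ler_normD _ _) _; apply: ltr_leD; first exact: HN1.
  rewrite /s iterS -/(s N) opprD addrACA subrr add0r.
  have -> : y ** s N - y ** l = y ** (s N - l).
    by rewrite bmulDr -[in RHS]scaleN1r bmulZr scaleN1r.
  rewrite (le_trans (normM_le _ _))// distrC.
  rewrite (le_trans (ler_wpM2r _ (ltW y1)))// mul1r; exact/ltW/HN.
by rewrite ltxx.
Qed.

Lemma Delta0_norm (theta : Delta0 A) x : `|set_val theta x| <= `|x|.
Proof.
rewrite real_leNgt ?ger0_real//; apply/negP => xt.
have t0 : set_val theta x != 0 by rewrite -normr_gt0 (le_lt_trans _ xt).
pose y := (set_val theta x)^-1 *: x.
have y1 : `|y| < 1.
  by rewrite normrZ normfV mulrC ltr_pdivrMr ?mul1r// normr_gt0.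
have ty : set_val theta y = 1 by rewrite Delta0Z mulVf.
have [s sE] := quasi_inverse y1.
have : set_val theta s = 1 + set_val theta s.
  by rewrite {1}sE linearD /= Delta0M ty mul1r.
by move/eqP; rewrite -subr_eq subrr eq_sym oner_eq0.
Qed.

End Automatic.

(* An alias of the product, so that it carries the sum norm rather than the
   library's max norm. *)
Definition lau (R : realType) (A1 A2 : banachAlgType R[i])
  (theta : Delta0 A2) : Type := (A1 * A2)%type.

Section Lau.
Context (R : realType) (A1 A2 : banachAlgType R[i]) (theta : Delta0 A2).
Local Notation L := (lau A1 theta).

HB.instance Definition _ := GRing.Lmodule.copy L (A1 * A2)%type.

Definition lau_norm (x : L) : R[i] := `|x.1| + `|x.2|.

Lemma lau_normD x y : lau_norm (x + y) <= lau_norm x + lau_norm y.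
Proof. by rewrite /lau_norm addrACA lerD// ler_normD. Qed.

Lemma lau_normZ (k : R[i]) x : lau_norm (k *: x) = `|k| * lau_norm x.
Proof. by rewrite /lau_norm !normrZ mulrDr. Qed.

Lemma lau_norm0_eq0 x : lau_norm x = 0 -> x = 0.
Proof.
move/eqP; rewrite /lau_norm paddr_eq0// !normr_eq0 => /andP[/eqP x1 /eqP x2].
by case: x x1 x2 => /= ? ? -> ->.
Qed.

HB.instance Definition _ := Lmodule_isNormed.Build R[i] L
  lau_normD lau_normZ lau_norm0_eq0.

Lemma lau_normE (x : L) : `|x| = `|x.1| + `|x.2|. Proof. by []. Qed.

Lemma lau_complete (F : set_system L) : ProperFilter F -> cauchy F -> cvg F.
Proof.
move=> FF Fc.
have Fe (e : R[i]) : 0 < e -> exists x : L, F (ball x e).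
  by move=> e0; move/cauchyP: Fc => /(_ _ e0).
have c1 : cvg ((fun x : L => x.1) @ F).
  apply: cauchy_cvg; apply/cauchy_exP => e /Fe[x Fx]; exists x.1.
  apply: (@filterS _ F _ _ _ _ Fx) => y xy; have {}xy : `|x - y| < e := xy.
  rewrite -ball_normE /ball_ /=; apply: le_lt_trans xy; rewrite lau_normE.
  by rewrite lerDl.
have c2 : cvg ((fun x : L => x.2) @ F).
  apply: cauchy_cvg; apply/cauchy_exP => e /Fe[x Fx]; exists x.2.
  apply: (@filterS _ F _ _ _ _ Fx) => y xy; have {}xy : `|x - y| < e := xy.
  rewrite -ball_normE /ball_ /=; apply: le_lt_trans xy; rewrite lau_normE.
  by rewrite lerDr.
move: c1 c2 => /cvg_ex[/= l1 c1] /cvg_ex[/= l2 c2]; apply/cvg_ex.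
exists ((l1, l2) : L); apply/cvgrPdist_lt => e e0.
have e2 : 0 < e / 2 by rewrite divr_gt0.
move/cvgrPdist_lt: c1 => /(_ _ e2) H1; move/cvgrPdist_lt: c2 => /(_ _ e2) H2.
apply: filterS2 H1 H2 => x /= H1 H2.
by rewrite lau_normE (splitr e) ltrD.
Qed.

HB.instance Definition _ := Uniform_isComplete.Build L lau_complete.

Definition lau_mul (a x : L) : L :=
  (a.1 ** x.1 + set_val theta x.2 *: a.1 + set_val theta a.2 *: x.1,
   a.2 ** x.2).

Lemma lau_mulA : associative lau_mul.
Proof.
move=> a b c; congr (_, _) => /=; last exact: mulgA.
rewrite !Delta0M !(bmulDr, bmulDl, bmulZl, bmulZr, scalerDr, scalerA) mulgA.
rewrite ![set_val theta c.2 * _]mulrC.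
by rewrite [LHS](AC (4*3) (1*3*5*(2*4*6)*7)).
Qed.

HB.instance Definition _ := isSemigroup.Build L lau_mulA.

Lemma lau_mulDl (x y z : L) : (x + y) ** z = x ** z + y ** z.
Proof.
congr (_, _) => /=; last exact: bmulDl.
rewrite bmulDl scalerDr linearD scalerDl.
by rewrite [LHS](AC (2*2*2) (1*3*5*(2*4*6))).
Qed.

Lemma lau_mulDr (x y z : L) : x ** (y + z) = x ** y + x ** z.
Proof.
congr (_, _) => /=; last exact: bmulDr.
rewrite bmulDr scalerDr linearD scalerDl.
by rewrite [LHS](AC (2*2*2) (1*3*5*(2*4*6))).
Qed.

Lemma lau_mulZl (k : R[i]) (x y : L) : (k *: x) ** y = k *: (x ** y).
Proof.
congr (_, _) => /=; last exact: bmulZl.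
by rewrite bmulZl !scalerDr Delta0Z !scalerA [k * set_val theta y.2]mulrC.
Qed.

Lemma lau_mulZr (k : R[i]) (x y : L) : x ** (k *: y) = k *: (x ** y).
Proof.
congr (_, _) => /=; last exact: bmulZr.
by rewrite bmulZr !scalerDr Delta0Z !scalerA [k * set_val theta x.2]mulrC.
Qed.

Lemma lau_normM (x y : L) : `|x ** y| <= `|x| * `|y|.
Proof.
rewrite !lau_normE /= mulrDl !mulrDr addrA lerD ?normM_le//.
rewrite (le_trans (ler_normD _ _))// lerD//; last first.
  by rewrite normrZ ler_wpM2r// Delta0_norm.
rewrite (le_trans (ler_normD _ _))// lerD ?normM_le//.
by rewrite normrZ mulrC ler_wpM2l// Delta0_norm.
Qed.

HB.instance Definition _ := isBanachAlgebra.Build R[i] L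
  lau_mulDl lau_mulDr lau_mulZl lau_mulZr lau_normM.

End Lau.

(* The Banach algebra of complex numbers. The alias is needed because the
   canonical [Complete] instance on [_^o] is reserved to real scalars. *)
Definition Calg (R : realType) : Type := R[i]^o.

Section Calg.
Context (R : realType).

HB.instance Definition _ := NormedModule.copy (Calg R) R[i]^o.

Lemma Calg_complete (F : set_system (Calg R)) :
  ProperFilter F -> cauchy F -> cvg F.
Proof.
move=> FF Fc.
have Fe (e : R) : 0 < e -> exists x : Calg R, F (ball x e%:C).
  by move=> e0; move/cauchyP: Fc; apply; rewrite ltcR.
have cRe : cvg ((fun z : Calg R => complex.Re z) @ F).
  apply: cauchy_cvg; apply/cauchy_exP => e /Fe[x Fx]; exists (complex.Re x).
  apply: (@filterS _ F _ _ _ _ Fx) => y xy; have {}xy : `|x - y| < e%:C := xy.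
  rewrite -ball_normE /ball_ /= -ltcR; apply: le_lt_trans xy.
  case: x y {Fx} => [a b] [c d].
  rewrite (_ : _ - _ = (a - c) +i* (b - d))// normc_def lecR /= -sqrtr_sqr.
  by rewrite ler_wsqrtr// lerDl sqr_ge0.
have cIm : cvg ((fun z : Calg R => complex.Im z) @ F).
  apply: cauchy_cvg; apply/cauchy_exP => e /Fe[x Fx]; exists (complex.Im x).
  apply: (@filterS _ F _ _ _ _ Fx) => y xy; have {}xy : `|x - y| < e%:C := xy.
  rewrite -ball_normE /ball_ /= -ltcR; apply: le_lt_trans xy.
  case: x y {Fx} => [a b] [c d].
  rewrite (_ : _ - _ = (a - c) +i* (b - d))// normc_def lecR /= -sqrtr_sqr.
  by rewrite ler_wsqrtr// lerDr sqr_ge0.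
move: cRe cIm => /cvg_ex[/= a ca] /cvg_ex[/= b cb]; apply/cvg_ex.
exists ((a +i* b) : Calg R); apply/cvgrPdist_lt => e e0.
have eE : e = (complex.Re e)%:C by rewrite RRe_real// gtr0_real.
have e2 : 0 < complex.Re e / 2 by rewrite divr_gt0// -ltcR -eE; exact: e0.
move/cvgrPdist_lt: ca => /(_ _ e2) H1; move/cvgrPdist_lt: cb => /(_ _ e2) H2.
apply: filterS2 H1 H2 => -[x y] /= H1 H2.
rewrite (_ : (a +i* b : Calg R) - (x +i* y) = (a - x) +i* (b - y))//.
rewrite eE (splitr (complex.Re e)) rmorphD [X in `|X|]complexE.
rewrite (le_lt_trans (ler_normD _ _))// normrM.
rewrite [X in X * _](_ : _ = 1); last first.
  by rewrite normc_def /= expr0n expr1n add0r sqrtr1.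
by rewrite mul1r ltrD// normc_def /= expr0n addr0 sqrtr_sqr ltcR.
Qed.

HB.instance Definition _ := Uniform_isComplete.Build (Calg R) Calg_complete.

HB.instance Definition _ := isSemigroup.Build (Calg R)
  (@mulrA R[i] : associative (fun a b : Calg R => a * b : R[i])).

Lemma Calg_mulDl (x y z : Calg R) : (x + y) ** z = x ** z + y ** z.
Proof. exact: (@mulrDl R[i]). Qed.

Lemma Calg_mulDr (x y z : Calg R) : x ** (y + z) = x ** y + x ** z.
Proof. exact: (@mulrDr R[i]). Qed.

Lemma Calg_mulZl (k : R[i]) (x y : Calg R) : (k *: x) ** y = k *: (x ** y).
Proof. by apply/esym; exact: (@mulrA R[i]). Qed.

Lemma Calg_mulZr (k : R[i]) (x y : Calg R) : x ** (k *: y) = k *: (x ** y).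
Proof. exact: (@mulrCA R[i]). Qed.

Lemma Calg_normM (x y : Calg R) : `|x ** y| <= `|x| * `|y|.
Proof. by rewrite -(@normrM R[i]). Qed.

HB.instance Definition _ := isBanachAlgebra.Build R[i] (Calg R)
  Calg_mulDl Calg_mulDr Calg_mulZl Calg_mulZr Calg_normM.

End Calg.

Lemma Delta0_zero (R : realType) (A : banachAlgType R[i]) :
  (\0 : {linear A -> R[i]^o}) \in Delta0 A.
Proof. by rewrite inE; right. Qed.

Lemma Delta0_id (R : realType) :
  (idfun : {linear Calg R -> R[i]^o}) \in Delta0 (Calg R).
Proof.
rewrite inE; left; split=> // id0.
have := congr1 (fun f : Calg R -> R[i] => f (1 : R[i])) id0.
by move/eqP; rewrite /= oner_eq0.
Qed.

(* As usual, [\0] yields componentwise multiplication and the identity of the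
   complex numbers yields the unitization: see the [_mulE] lemmas below. *)
Definition direct_product (R : realType) (A1 A2 : banachAlgType R[i]) :
  banachAlgType R[i] :=
  lau A1 (SigSub (Delta0_zero A2)).

Definition unitization (R : realType) (A : banachAlgType R[i]) :
  banachAlgType R[i] := lau A (SigSub (Delta0_id R)).

Lemma lau_mulE (R : realType) (A1 A2 : banachAlgType R[i]) (theta : Delta0 A2)
    (a x : lau A1 theta) :
  a ** x = (a.1 ** x.1 + set_val theta x.2 *: a.1 + set_val theta a.2 *: x.1,
            a.2 ** x.2).
Proof. by []. Qed.

Lemma direct_product_mulE (R : realType) (A1 A2 : banachAlgType R[i])
    (a x : direct_product A1 A2) :
  a ** x = (a.1 ** x.1, a.2 ** x.2).
Proof. by rewrite lau_mulE /= !scale0r !addr0. Qed.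

Lemma unitization_mulE (R : realType) (A : banachAlgType R[i])
    (a x : unitization A) :
  a ** x = (a.1 ** x.1 + (x.2 : R[i]) *: a.1 + (a.2 : R[i]) *: x.1,
            (a.2 : R[i]) * x.2).
Proof. by []. Qed.

(* Main.v *)
(* A derivation on the Lau product is the sum of its restrictions to the two
   factors, which are derivations at the restrictions of the character. Such a
   restriction may be the zero functional; then the derivation kills all
   products, hence vanishes when the factor is essential. Conversely, a
   derivation of a factor extends by zero to the product. *)
Require Import Defs.
From HB Require Import structures.
From mathcomp Require Import all_boot all_order all_algebra.
From mathcomp Require Import complex.
From mathcomp Require Import boolp classical_sets functions reals.
From mathcomp Require Import topology normedtype sequences.

Set Implicit Arguments.
Unset Strict Implicit.
Unset Printing Implicit Defensive.

Import Order.TTheory GRing.Theory Num.Theory.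
Import numFieldNormedType.Exports.

Local Open Scope classical_set_scope.
Local Open Scope ring_scope.
Local Open Scope complex_scope.

(** The structure proofs packed with the function are propositions, so proof irrelevance identifies
    them once the functions agree. *)
Lemma linear_ext (K : pzSemiRingType) (U : lSemiModType K) (V : nmodType)
    (s : K -> V -> V) (f g : {linear U -> V | s}) :
  f =1 g -> f = g.
Proof.
move=> /funext; case: f g => [f cf] [g cg] /= fg.
case: _ / fg in cg *; congr GRing.Linear.Pack.
case: cf cg => [[f1] [f2]] [[g1] [g2]].
by rewrite (Prop_irrelevance f1 g1) (Prop_irrelevance f2 g2).
Qed.

Lemma linear_nonexpansive_continuous (K : numFieldType) (U V : normedModType K)
    (f : {linear U -> V}) :
  (forall x, `|f x| <= `|x|) -> continuous f.
Proof.
move=> f1 x; apply/cvgrPdist_lt => e e0.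
have /cvgrPdist_lt /(_ _ e0) : y @[y --> x] --> x by exact: cvg_id.
apply: filterS => y.
by rewrite /= -linearB; exact: le_lt_trans (f1 _).
Qed.

(** The set where [f] is nonzero is open, so if it were nonempty it would meet [S]. *)
Lemma continuous_dense_eq0 (K : numFieldType) (U V : normedModType K)
    (f : U -> V) (S : set U) :
  continuous f -> dense S -> (forall x, S x -> f x = 0) -> forall x, f x = 0.
Proof.
move=> cf dS fS x; apply: contrapT => fx0.
have oO : open (f @^-1` ~` [set 0]).
  apply: open_comp; first by move=> *; exact: cf.
  apply/closed_openC/accessible_closed_set1/hausdorff_accessible.
  exact: norm_hausdorff.
have [|y [/= fy0 /fS]] := dS _ _ oO; first by exists x.
exact: fy0.
Qed.

Section PointDerivations.
Context (R : realType).
Local Notation C := R[i].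
Implicit Types A B : banachAlgType C.

Lemma bmul0l A (x : A) : 0 ** x = 0.
Proof. by rewrite -(scale0r (0 : A)) bmulZl !scale0r. Qed.

Definition algebra_morph A B (f : A -> B) := forall a b, f (a ** b) = f a ** f b.

Definition multiplicative A (phi : A -> C) :=
  forall a b, phi (a ** b) = phi a * phi b.

(* Unlike point amenability, this includes derivations at the zero functional. *)
Definition derivation_free A := forall phi d : {linear A -> C^o},
  multiplicative phi -> cont_point_derivation phi d -> forall x, d x = 0.

(** This pointwise form lets derivations be pulled back and evaluated without comparing packed
    linear maps. *)
Lemma point_amenableP A : point_amenable A <->
  forall phi d : {linear A -> C^o}, Delta A phi ->
    cont_point_derivation phi d -> forall x, d x = 0.
Proof.
split=> [pA phi d Dphi dd x|H phi Dphi [d [dd d0]]].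
  apply: contrapT => dx; apply: (pA _ Dphi); exists d; split=> // d0.
  by apply: dx; rewrite d0.
by apply: d0; apply: linear_ext; exact: H dd.
Qed.

Lemma cont_point_derivation_comp A B (f : {linear A -> B})
    (phi d : {linear B -> C^o}) :
  continuous f -> algebra_morph f -> cont_point_derivation phi d ->
  cont_point_derivation (phi \o f) (d \o f).
Proof.
move=> cf fM [cd dM]; split=> [x|a b /=]; last by rewrite fM dM.
by apply: continuous_comp; [exact: cf|exact: cd].
Qed.

(** Both [phi] and [d] pull back along [f]. Surjectivity keeps [phi \o f] nonzero and lets [d \o f]
    reach every value of [d]. *)
Lemma point_amenable_surj A B (f : {linear A -> B}) :
  continuous f -> algebra_morph f -> (forall b, exists a, f a = b) ->
  point_amenable A -> point_amenable B.
Proof.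
move=> cf fM fS /point_amenableP pA; apply/point_amenableP.
move=> phi d [phi0 phiM] dd y.
have [x <-] := fS y.
apply: (pA (phi \o f) (d \o f)); last exact: cont_point_derivation_comp.
split=> [phif0|a b /=]; last by rewrite fM phiM.
apply: phi0; apply/funext => b; have [a <-] := fS b.
by have := congr1 (@^~ a) phif0.
Qed.

Lemma essential_derivation_free A :
  essential A -> point_amenable A -> derivation_free A.
Proof.
move=> eA /point_amenableP pA phi d phiM dd.
have [phi0|phi0] := pselect (phi = \0 :> (A -> C)); last exact: pA dd.
case: dd => cd dM; apply: (continuous_dense_eq0 cd eA) => _ [n [c [v [vS ->]]]].
rewrite linear_sum big1// => i _; rewrite linearZ.
by have [a _ [b _ <-]] := vS i; rewrite dM phi0 /= mulr0 mul0r addr0 scaler0.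
Qed.

Lemma Calg_derivation_free : derivation_free (Calg R).
Proof.
(* The unit is idempotent, which forces [d e = 0]. *)
move=> phi d phiM [_ dM] x; pose e : Calg R := (1 : C).
have ee : e ** e = e := mulr1 (1 : C).
have d0 : d e = 0.
  (* Idempotency makes [phi e] either 0 or 1, so the derivation identity at [e] reads [d e = 0] or
     [d e = d e + d e]. *)
  have := phiM e e; have := dM e e; rewrite ee => de /esym/eqP.
  rewrite -subr_eq0 -{3}[phi e]mulr1 -mulrBr mulf_eq0 subr_eq0.
  case/orP => /eqP pe; move: de; rewrite pe ?mulr0 ?mul0r ?addr0//.
  rewrite mulr1 mul1r => /eqP; rewrite -subr_eq subrr eq_sym => /eqP//.
have -> : x = (x : C) *: e by exact/esym/mulr1.
by rewrite linearZ d0 /= scaler0.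
Qed.

Section Lau.
Context (A1 A2 : banachAlgType C) (theta : Delta0 A2).
Local Notation L := (lau A1 theta).

Definition lau_fst (x : L) : A1 := x.1.
Definition lau_snd (x : L) : A2 := x.2.
Definition lau_inl (a : A1) : L := (a, 0).
Definition lau_inr (b : A2) : L := (0, b).

Fact lau_fst_linear : linear lau_fst. Proof. by []. Qed.
Fact lau_snd_linear : linear lau_snd. Proof. by []. Qed.
Fact lau_inl_linear : linear lau_inl.
Proof. by move=> k x y; congr (_, _); rewrite /= scaler0 addr0. Qed.
Fact lau_inr_linear : linear lau_inr.
Proof. by move=> k x y; congr (_, _); rewrite /= scaler0 addr0. Qed.

HB.instance Definition _ :=
  GRing.isLinear.Build C L A1 *:%R lau_fst lau_fst_linear.
HB.instance Definition _ :=
  GRing.isLinear.Build C L A2 *:%R lau_snd lau_snd_linear.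
HB.instance Definition _ :=
  GRing.isLinear.Build C A1 L *:%R lau_inl lau_inl_linear.
HB.instance Definition _ :=
  GRing.isLinear.Build C A2 L *:%R lau_inr lau_inr_linear.

Lemma lau_fst_continuous : continuous lau_fst.
Proof.
by apply: linear_nonexpansive_continuous => x; rewrite lau_normE lerDl.
Qed.

Lemma lau_snd_continuous : continuous lau_snd.
Proof.
by apply: linear_nonexpansive_continuous => x; rewrite lau_normE lerDr.
Qed.

Lemma lau_inl_continuous : continuous lau_inl.
Proof.
by apply: linear_nonexpansive_continuous => x; rewrite lau_normE /= normr0 addr0.
Qed.

Lemma lau_inr_continuous : continuous lau_inr.
Proof.
by apply: linear_nonexpansive_continuous => x; rewrite lau_normE /= normr0 add0r.
Qed.

(** Each cross term of the product carries the scalar [theta 0], which is 0. *)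
Lemma lau_inlM : algebra_morph lau_inl.
Proof.
by move=> a b; rewrite lau_mulE /= linear0 !scale0r !addr0 bmul0l.
Qed.

Lemma lau_inrM : algebra_morph lau_inr.
Proof. by move=> a b; rewrite lau_mulE /= !scaler0 !addr0 bmul0l. Qed.

Lemma lau_point_amenable_snd : point_amenable L -> point_amenable A2.
Proof.
apply: (point_amenable_surj lau_snd_continuous) => // b.
by exists (lau_inr b).
Qed.

(** For nonzero [theta] the projection [lau_fst] need not be multiplicative, so
    [point_amenable_surj] cannot be used as for the second factor. *)
Lemma lau_point_amenable_fst : point_amenable L -> point_amenable A1.
Proof.
move=> /point_amenableP pL.
apply/point_amenableP => phi d [phi0 phiM] [cd dM] x.
(* A character [phi] of the first factor extends to the product as
   [phi + theta], and [d] extends by zero. *)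
pose psi : {linear L -> C^o} := (phi \o lau_fst) \+ (set_val theta \o lau_snd).
apply: (pL psi (d \o lau_fst) _ _ (lau_inl x)); split.
(* [psi] is nonzero because it restricts to [phi] along [lau_inl]. *)
- move=> psi0; apply: phi0; apply/funext => a.
  have := congr1 (@^~ (lau_inl a)) psi0.
  by rewrite /= linear0 addr0.
(* The two [theta] terms of the Lau product are the cross terms of [(phi a.1 + theta a.2) * (phi b.1
   + theta b.2)]. *)
- move=> a b; rewrite /= !linearD !linearZ /= phiM Delta0M.
  rewrite mulrDl !mulrDr !addrA [_ *: phi a.1]mulrC.
  by congr (_ + _).
- by move=> y; apply: continuous_comp; [exact: lau_fst_continuous|exact: cd].
(* Applied to the same two terms, [d] supplies the [theta] part of [psi] in the derivation
   identity. *)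
- move=> a b; rewrite /= !linearD !linearZ /= dM.
  rewrite mulrDr mulrDl [_ *: d a.1]mulrC.
  by rewrite [RHS]addrACA addrA.
Qed.

Lemma lau_point_amenable :
  derivation_free A1 -> derivation_free A2 -> point_amenable L.
Proof.
move=> f1 f2; apply/point_amenableP => phi d [_ phiM] dd x.
have -> : x = lau_inl x.1 + lau_inr x.2.
  by case: x => a b; congr (_, _); rewrite /= ?addr0 ?add0r.
rewrite linearD.
have -> : d (lau_inl x.1) = 0.
  apply: (f1 (phi \o lau_inl) (d \o lau_inl)) => [a b|].
    by rewrite /= lau_inlM phiM.
  exact: cont_point_derivation_comp lau_inl_continuous lau_inlM dd.
have -> : d (lau_inr x.2) = 0.
  apply: (f2 (phi \o lau_inr) (d \o lau_inr)) => [a b|].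
    by rewrite /= lau_inrM phiM.
  exact: cont_point_derivation_comp lau_inr_continuous lau_inrM dd.
exact: addr0.
Qed.

End Lau.

End PointDerivations.

Theorem theorem3p3 (R : realType) (A1 A2 : banachAlgType R[i])
    (theta : Delta0 A2) :
  [/\ point_amenable (lau A1 theta) -> point_amenable A1 /\ point_amenable A2,
      point_amenable (direct_product A1 A2) -> point_amenable A1 /\ point_amenable A2 &
      point_amenable (unitization A1) -> point_amenable A1] /\
  (essential A1 -> essential A2 ->
    [/\ point_amenable A1 /\ point_amenable A2 ->
          point_amenable (lau A1 theta),
        point_amenable A1 /\ point_amenable A2 ->
          point_amenable (direct_product A1 A2) &
        point_amenable A1 -> point_amenable (unitization A1)]).
Proof.
split.
  split=> pL; [split|split|].
  - exact: lau_point_amenable_fst pL.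
  - exact: lau_point_amenable_snd pL.
  - exact: lau_point_amenable_fst pL.
  - exact: lau_point_amenable_snd pL.
  - exact: lau_point_amenable_fst pL.
move=> e1 e2; split=> [[p1 p2]|[p1 p2]|p1].
- by apply: lau_point_amenable; exact: essential_derivation_free.
- by apply: lau_point_amenable; exact: essential_derivation_free.
(* The second factor is now the algebra of complex numbers, where the unit does the work of
   essentiality. *)
- apply: lau_point_amenable; last exact: Calg_derivation_free.
  exact: essential_derivation_free.
Qed.
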